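(* Let $n\ge 1$ be an integer. Let $\mathrm{OPT}$ be the optimal value of the linear program, in real variables $q_1,\dots,q_n$, $$\max\; q_1-q_n$$ subject to $$\sum_{i=1}^k q_i \le \frac{k}{2}\ln k + k q_k \quad\text{for } k=1,\dots,n,$$ $$\sum_{i=1}^k q_i \le \frac{k}{2}\ln\!\left(\tfrac{11}{4}k\right) + (k-\ell)q_{k+\ell} + \ell q_k \quad\text{for } k=2,\dots,n-1 \text{ and } \ell=1,\dots,\min\{k-1,n-k\}.$$ Then the optimal value of the optimization problem, in positive real variables $p_1,\dots,p_n$, $$\max\; p_1/p_n$$ subject to $$\prod_{i=1}^k p_i \le k^{k/2}p_k^k \quad\text{for } k=1,\dots,n,$$ $$\prod_{i=1}^k p_i \le \frac{k^k\, p_{k+\ell}^{\,k-\ell}\,(p_k+p_{k+\ell})^\ell}{(k-\ell)^{\frac{k-\ell}{2}}\,\ell^{\frac{\ell}{2}}} \quad\text{for } k=2,\dots,n-1 \text{ and } \ell=1,\dots,\min\{k-1,n-k\},$$ lies in the interval $[\,n^{-3/2}e^{\mathrm{OPT}},\; e^{\mathrm{OPT}}\,]$.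
   Context: The optimal value of a maximization problem is the supremum of its objective over its feasible points. Index ranges that are empty contribute no constraints. *)

(* Defs.v *)
From mathcomp Require Import all_boot all_order all_algebra.
From mathcomp Require Import all_classical all_reals all_analysis.

Set Implicit Arguments.
Unset Strict Implicit.
Unset Printing Implicit Defensive.

Import Order.TTheory GRing.Theory Num.Theory.

Local Open Scope classical_set_scope.
Local Open Scope ring_scope.

(* A point (x_1, ..., x_n) is an n-tuple x, and x`_i is its 0-based i-th entry:
   the coordinate x_k of the text is x`_k.-1. Every index used below is in
   bounds when 1 <= n, so the default value 0 of x`_i never occurs. *)

Definition lp_feasible (R : realType) (n : nat) (q : n.-tuple R) : Prop :=
  (forall k : nat, (1 <= k <= n)%N ->
     \sum_(1 <= i < k.+1) q`_i.-1 <= k%:R / 2 * ln k%:R + k%:R * q`_k.-1) /\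
  (forall k l : nat, (2 <= k <= n - 1)%N -> (1 <= l <= minn (k - 1) (n - k))%N ->
     \sum_(1 <= i < k.+1) q`_i.-1
       <= k%:R / 2 * ln (11 / 4 * k%:R)
          + (k - l)%:R * q`_(k + l).-1 + l%:R * q`_k.-1).

Definition lp_opt (R : realType) (n : nat) : \bar R :=
  ereal_sup [set (q`_0 - q`_n.-1)%:E | q in @lp_feasible R n].

Definition prod_feasible (R : realType) (n : nat) (p : n.-tuple R) : Prop :=
  [/\ forall k : nat, (1 <= k <= n)%N -> 0 < p`_k.-1,
      forall k : nat, (1 <= k <= n)%N ->
        \prod_(1 <= i < k.+1) p`_i.-1 <= k%:R `^ (k%:R / 2) * p`_k.-1 ^+ k
    & forall k l : nat, (2 <= k <= n - 1)%N ->
        (1 <= l <= minn (k - 1) (n - k))%N ->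
        \prod_(1 <= i < k.+1) p`_i.-1
          <= k%:R ^+ k * p`_(k + l).-1 ^+ (k - l) * (p`_k.-1 + p`_(k + l).-1) ^+ l
             / ((k - l)%:R `^ ((k - l)%:R / 2) * l%:R `^ (l%:R / 2))].

Definition prod_opt (R : realType) (n : nat) : \bar R :=
  ereal_sup [set (p`_0 / p`_n.-1)%:E | p in @prod_feasible R n].

(* Main.v *)
(** If p is feasible for the product problem, then q = ln p is feasible for the
linear program. The first family of constraints is literally the same. For the
second one put x = l/k, r = p_(k+l)/p_k, c = ln (11/4). If 2(1-x)(- ln r) <= c,
the first constraint at k already implies the linear one. Otherwise the
logarithm of the product constraint implies it, provided
H(x) + 2x ln(1+r) <= c, where H is the binary entropy. Bounding H by ln 2 and
x by 1 - c/(2(- ln r)), this reduces to the one-variable inequality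
  ln(1+r) (2 (- ln r) - c) <= (- ln r) ln(11/8)   (0 < r <= 1),
which holds with a relative slack of about two percent near r = 0.35 and is
checked on finitely many intervals.

Conversely, if q is feasible for the linear program, then p_i = i^(3/2) e^(q_i)
is feasible for the product problem, because (k!)^3 (11/4)^k <= k^(3k) for
k >= 2; and p_1/p_n = n^(-3/2) e^(q_1-q_n). *)

From Stdlib Require Import PArith.
Require Import Defs.
From mathcomp Require Import all_boot all_order all_algebra.
From mathcomp Require Import all_classical all_reals all_analysis.
From mathcomp Require Import ring lra zify.

Import Order.TTheory GRing.Theory Num.Theory.

Local Open Scope ring_scope.

(** * Elementary logarithm and entropy inequalities *)

Lemma ln_le_log2_bound (R : realType) (x : R) (q A : nat) :
  0 < x -> x ^+ q <= 2 ^+ A -> q%:R * ln x <= A%:R * ln 2.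
Proof.
move=> x0 h; rewrite !mulr_natl -!lnXn //.
by rewrite ler_ln ?posrE ?exprn_gt0.
Qed.

(** Concavity of z ↦ - z ln z: add its tangent-line bounds at the midpoint (m + l) / 2, taken for z
    = m and z = l. *)
Lemma entropy_le_ln2 (R : realType) (m l : R) : 0 < m -> 0 < l ->
  (m + l) * ln (m + l) - m * ln m - l * ln l <= (m + l) * ln 2.
Proof.
move=> m0 l0.
have tangent (z : R) : 0 < z -> z * (ln (m + l) - ln 2 - ln z) <= (m + l) / 2 - z.
  move=> z0.
  have -> : ln (m + l) - ln 2 - ln z = ln (1 + ((m + l) / 2 / z - 1)).
    rewrite (addrC 1) subrK !ln_div ?posrE ?divr_gt0 ?addr_gt0 //; lra.
  have -> : (m + l) / 2 - z = z * ((m + l) / 2 / z - 1) by field; lra.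
  rewrite ler_pM2l // le_ln1Dx // ltrBrDl subrr !divr_gt0 ?addr_gt0 //; lra.
by move: (tangent m m0) (tangent l l0); lra.
Qed.

(* With L = - ln r, u = ln (1 + r), c = ln (11/4) and t = ln 2 the conclusion is
   the inequality of the header; A, B, C are bounds for L, u, c in base 2. *)
Lemma log_cell_bound (R : realType) (A B C t L u c : R) :
  0 < t -> 1 <= C -> 0 <= A -> 0 <= L -> 0 <= u ->
  C * t <= c -> L <= A * t -> u <= B * t ->
  B * (2 * A - C) <= A * (C - 1) ->
  u * (2 * L - c) <= L * (c - t).
Proof.
move=> t0 C1 A0 L0 u0 hc hL hu hAB.
(* The slack L (c - t) - u (2 L - c) has slope L + u >= 0 in c, so c may be lowered to [C * t]. *)
have e1 : u * (2 * L - C * t) <= L * (C * t - t).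
  have C0 : 0 <= (C - 1) * t by rewrite mulr_ge0 ?subr_ge0 // ltW.
  have [h1|h1] := leP (2 * u) ((C - 1) * t); first by have := mulr_ge0 u0 (ltW t0); nra.
  (* Now the coefficient of L is positive, so the worst case is L = A t; what remains is linear in
     u, with worst case u = B t. *)
  have h2 : (2 * u - (C - 1) * t) * L <= (2 * u - (C - 1) * t) * (A * t).
    by rewrite ler_wpM2l // subr_ge0 ltW.
  suff : u * (2 * A - C) <= A * (C - 1) * t by nra.
  have h3 : 0 <= A * (C - 1) * t by rewrite -mulrA mulr_ge0.
  have [h4|h4] := leP (2 * A) C; first by nra.
  by nra.
have h5 : 0 <= u * (c - C * t) by rewrite mulr_ge0 // subr_ge0.
have h6 : 0 <= L * (c - C * t) by rewrite mulr_ge0 // subr_ge0.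
lra.
Qed.

(** * Interval check of the one-variable inequality by integer arithmetic *)

Local Notation pnat := nat_of_pos.

Lemma nat_of_exp_pos (x y : positive) : pnat (Pos.pow x y) = (pnat x ^ pnat y)%N.
Proof.
elim/Pos.peano_ind: y => [|y IHy]; first by rewrite Pos.pow_1_r.
by rewrite Pos.pow_succ_r nat_of_mul_pos IHy nat_of_succ_pos expnS.
Qed.

Lemma leq_nat_of_pos (x y : positive) : Pos.leb x y -> (pnat x <= pnat y)%N.
Proof.
move=> /Pos.leb_le /Pos.le_lteq[/Pos.lt_iff_add[z <-]|-> //].
by rewrite nat_of_add_pos leq_addr.
Qed.

Lemma pnat_gt0 (x : positive) : (0 < pnat x)%N.
Proof. by elim/Pos.peano_ind: x => [|x _] //; rewrite nat_of_succ_pos. Qed.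

(** A rational bound A/q on log_2 (y/x) becomes a comparison of integer powers, which binary
    [positive] numbers make cheap to compute. *)
Lemma ln_pos_ratio_bound (R : realType) (x y q A : positive) :
  Pos.leb (y ^ q) (2 ^ A * x ^ q) ->
  (pnat q)%:R * ln ((pnat y)%:R / (pnat x)%:R : R) <= (pnat A)%:R * ln 2.
Proof.
move=> /leq_nat_of_pos; rewrite nat_of_mul_pos !nat_of_exp_pos -(ler_nat R) natrM !natrX => h.
have x0 : 0 < (pnat x)%:R :> R by rewrite ltr0n pnat_gt0.
apply: ln_le_log2_bound; first by rewrite divr_gt0 // ltr0n pnat_gt0.
by rewrite expr_div_n ler_pdivrMr // exprn_gt0.
Qed.

(* The entry (a, (A, p), (B, q)) covers a/1000 <= r < b/1000, where b is the
   previous breakpoint; A/p and B/q are upper bounds for log_2 (1000/a) and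
   log_2 (1 + b/1000). The constant 35/24 is a lower bound for log_2 (11/4). *)
Definition log_cell : Type := positive * (positive * positive) * (positive * positive).

Definition log_cell_ok (b : positive) (x : log_cell) : bool :=
  let: (a, (A, p), (B, q)) := x in
  [&& Pos.leb (1000 ^ p) (2 ^ A * a ^ p),
      Pos.leb ((1000 + b) ^ q) (2 ^ B * 1000 ^ q)
    & Pos.leb (48 * (A * B)) (11 * (A * q) + 35 * (B * p))]%positive.

(** On a cell, - ln r is largest at the left end and ln (1 + r) at the right end. The third test is
    the last hypothesis of [log_cell_bound] with C = 35/24, denominators cleared. *)
Lemma log_cell_ok_bound (R : realType) (b : positive) (x : log_cell) (r : R) : log_cell_ok b x ->
  (pnat x.1.1)%:R / 1000 <= r < (pnat b)%:R / 1000 -> r <= 1 ->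
  ln (1 + r) * (2 * - ln r - ln (11 / 4)) <= - ln r * ln (11 / 8).
Proof.
case: x => [[a [A p]] [B q]] /and3P[].
move=> /(ln_pos_ratio_bound R) hA /(ln_pos_ratio_bound R) hB.
move=> /leq_nat_of_pos; rewrite !(nat_of_add_pos, nat_of_mul_pos) => hAB /= /andP[ar rb] r1.
(* Since 16/11 = 4 / (11/4), this says log_2 (11/4) >= 2 - 13/24 = 35/24. *)
have hC : (pnat 24)%:R * ln ((pnat 16)%:R / (pnat 11)%:R : R) <= (pnat 13)%:R * ln 2.
  by apply: ln_pos_ratio_bound; vm_compute.
have a0 : 0 < (pnat a)%:R :> R by rewrite ltr0n pnat_gt0.
have p0 : 0 < (pnat p)%:R :> R by rewrite ltr0n pnat_gt0.
have q0 : 0 < (pnat q)%:R :> R by rewrite ltr0n pnat_gt0.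
have k0 : 0 < 1000 :> R by rewrite ltr0n.
have r0 : 0 < r by apply: lt_le_trans (divr_gt0 a0 k0) ar.
have ln2 : 0 < ln 2 :> R by rewrite ln_gt0 // ltr1n.
have c8 : ln (11 / 8) = ln (11 / 4) - ln 2 :> R.
  by rewrite -ln_div ?posrE ?divr_gt0 ?ltr0n //; congr ln; field.
have hL : - ln r <= (pnat A)%:R / (pnat p)%:R * ln 2.
  rewrite mulrAC ler_pdivlMr // mulrC.
  apply: le_trans hA; rewrite ler_pM2l // -lnV ?posrE //.
  have ira : r^-1 <= (pnat 1000)%:R / (pnat a)%:R.
    rewrite ler_pdivlMr // mulrC ler_pdivrMr //.
    by move: ar; rewrite ler_pdivrMr ?ltr0n // mulrC.
  by rewrite ler_ln ?posrE ?invr_gt0 // (lt_le_trans _ ira) ?invr_gt0.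
have hu : ln (1 + r) <= (pnat B)%:R / (pnat q)%:R * ln 2.
  rewrite mulrAC ler_pdivlMr // mulrC.
  apply: le_trans hB; rewrite ler_pM2l // nat_of_add_pos natrD.
  have ir : 1 + r <= ((pnat 1000)%:R + (pnat b)%:R) / (pnat 1000)%:R.
    rewrite mulrDl divff ?pnatr_eq0 // lerD2l; exact: ltW.
  by rewrite ler_ln ?posrE // ?(lt_le_trans _ ir) // addr_gt0.
have hc : 35 / 24 * ln 2 <= ln (11 / 4) :> R.
  have e : ln ((pnat 16)%:R / (pnat 11)%:R) = 2 * ln 2 - ln (11 / 4) :> R.
    rewrite (mulr_natl _ 2) -lnXn ?ltr0n // -ln_div ?posrE ?exprn_gt0 ?divr_gt0 ?ltr0n //.
    by congr ln; rewrite /=; field.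
  by move: hC; rewrite e /=; clear; lra.
rewrite c8; apply: (log_cell_bound R _ _ (35 / 24) _ _ _ _ ln2 _ _ _ _ hc hL hu).
- by clear; lra.
- by rewrite divr_ge0 ?ler0n.
- by rewrite oppr_ge0 ln_le0.
- by rewrite ln_ge0 // lerDl ltW.
move: hAB; rewrite -(ler_nat R) !(natrM, natrD) /= => hAB.
rewrite -subr_ge0.
have -> : (pnat A)%:R / (pnat p)%:R * (35 / 24 - 1)
    - (pnat B)%:R / (pnat q)%:R * (2 * ((pnat A)%:R / (pnat p)%:R) - 35 / 24)
  = (11 * ((pnat A)%:R * (pnat q)%:R) + 35 * ((pnat B)%:R * (pnat p)%:R)
     - 48 * ((pnat A)%:R * (pnat B)%:R)) / (24 * ((pnat p)%:R * (pnat q)%:R)) :> R.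
  by field; rewrite !gt_eqF.
by rewrite divr_ge0 ?subr_ge0 // !mulr_ge0 // ltW.
Qed.

(** The left end of each cell is passed on as the right end of the next, so the cells leave no
    gap. *)
Fixpoint log_cells_ok (b : positive) (s : seq log_cell) : bool :=
  if s is x :: s' then log_cell_ok b x && log_cells_ok x.1.1 s' else true.

Lemma log_cells_ok_bound (R : realType) (r : R) (s : seq log_cell) (b : positive) :
  log_cells_ok b s ->
  (pnat (last b [seq x.1.1 | x <- s]))%:R / 1000 <= r < (pnat b)%:R / 1000 -> r <= 1 ->
  ln (1 + r) * (2 * - ln r - ln (11 / 4)) <= - ln r * ln (11 / 8).
Proof.
elim: s b => [b _ /andP[h1 h2]|x s IHs b /= /andP[hc hs] /andP[ar rb] r1].
  by move: (le_lt_trans h1 h2); rewrite ltxx.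
have [rx|rx] := ltP r ((pnat x.1.1)%:R / 1000); first by apply: (IHs x.1.1) => //; rewrite ar.
by apply: (log_cell_ok_bound _ _ _ _ hc) => //; rewrite rx.
Qed.

(* Breakpoints from 0.604, where - 2 ln r <= ln (11/4), down to 0.172, where
   2 ln (1 + r) <= ln (11/8): beyond either end the inequality is trivial. *)
Definition log_cells : seq log_cell :=
  [:: (535, (28, 31), (15, 22)); (449, (37, 32), (13, 21)); (414, (14, 11), (15, 28));
    (394, (43, 32), (1, 2)); (381, (39, 28), (12, 25)); (372, (10, 7), (7, 15));
    (364, (35, 24), (16, 35)); (357, (55, 37), (13, 29)); (352, (59, 39), (15, 34));
    (345, (43, 28), (17, 39)); (338, (36, 23), (3, 7)); (332, (35, 22), (8, 19));
    (324, (57, 35), (12, 29)); (313, (57, 34), (15, 37)); (300, (40, 23), (13, 33));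
    (280, (68, 37), (11, 29)); (248, (81, 40), (5, 14)); (172, (94, 37), (8, 25))]%positive.

Lemma ln1p_oppln_bound (R : realType) (r : R) : 0 < r <= 1 ->
  ln (1 + r) * (2 * - ln r - ln (11 / 4)) <= - ln r * ln (11 / 8).
Proof.
move=> /andP[r0 r1].
have L0 : 0 <= - ln r by rewrite oppr_ge0 ln_le0.
have u0 : 0 <= ln (1 + r) by rewrite ln_ge0 // lerDl ltW.
have d0 : 0 <= ln (11 / 8) :> R by rewrite ln_ge0 //; lra.
(* Here 11/4 * 0.604^2 > 1, so the factor 2 (- ln r) - ln (11/4) is nonpositive. *)
have [h1|h1] := leP (604 / 1000) r.
  have : 0 <= ln (11 / 4 * r ^+ 2) by rewrite ln_ge0 // expr2; nra.
  rewrite lnM ?posrE ?exprn_gt0 ?divr_gt0 ?ltr0n // lnXn // mulr2n => h2.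
  apply: le_trans (mulr_ge0 L0 d0).
  by rewrite mulr_ge0_le0 //; lra.
(* Here 1.172^2 < 11/8. *)
have [h2|h2] := leP (172 / 1000) r; last first.
  have r1_gt0 : 0 < 1 + r by lra.
  have h3 : 2 * ln (1 + r) <= ln (11 / 8).
    rewrite mulr_natl -lnXn // ler_ln ?posrE ?exprn_gt0 ?divr_gt0 ?ltr0n //.
    by rewrite expr2; nra.
  have c0 : 0 <= ln (11 / 4) :> R by rewrite ln_ge0 //; lra.
  by nra.
have ok : log_cells_ok 604 log_cells by vm_compute.
by apply: (log_cells_ok_bound _ _ _ _ ok); [rewrite h2 h1|].
Qed.

(** * The second linear constraint *)

(** Used with m = k - l, a = p_k, b = p_(k+l) and S the logarithm of the product p_1 ... p_k; the
    two bounds on S are the logarithms of the product constraints. *)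
Lemma lp_constraint2_of_prod (R : realType) (m l a b S : R) :
  0 < m -> 0 < l -> 0 < a -> 0 < b ->
  S <= (m + l) / 2 * ln (m + l) + (m + l) * ln a ->
  S <= (m + l) * ln (m + l) + m * ln b + l * ln (a + b) - (m / 2 * ln m + l / 2 * ln l) ->
  S <= (m + l) / 2 * ln (11 / 4 * (m + l)) + m * ln b + l * ln a.
Proof.
move=> m0 l0 a0 b0 h1 h2.
have ml0 : 0 < m + l by exact: addr_gt0.
have r0 : 0 < b / a by exact: divr_gt0.
have eb : ln b = ln a + ln (b / a) by rewrite ln_div ?posrE //; lra.
have eab : ln (a + b) = ln a + ln (1 + b / a).
  by rewrite -lnM ?posrE ?addr_gt0 //; congr ln; field; rewrite gt_eqF.
have e0 : 0 < 11 / 4 :> R by lra.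
have ek : ln (11 / 4 * (m + l)) = ln (11 / 4) + ln (m + l) by rewrite lnM.
have c0 : 0 < ln (11 / 4) :> R by rewrite ln_gt0 //; lra.
have ed : ln (11 / 8) = ln (11 / 4) - ln 2 :> R.
  by rewrite -ln_div ?posrE //; congr ln; lra.
have ent := @entropy_le_ln2 R m l m0 l0.
move: h1 h2; rewrite ek eab eb => h1 h2.
have [h3|h3] := ltP (2 * m * - ln (b / a)) ((m + l) * ln (11 / 4)).
  by apply: le_trans h1 _; lra.
have mL : 0 < m * - ln (b / a).
  have := mulr_gt0 ml0 c0; lra.
have L0 : 0 < - ln (b / a) by rewrite -(pmulr_rgt0 _ m0).
have r1 : b / a <= 1.
  by rewrite leNgt; apply/negP => /ln_gt0; lra.
have u0 : 0 <= ln (1 + b / a) by rewrite ln_ge0 // lerDl ltW.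
have := @ln1p_oppln_bound R (b / a); rewrite r0 r1 => /(_ isT).
rewrite ed; move: (ln (1 + b / a)) (ln (b / a)) u0 L0 h2 h3 => u L' u0 L0 h2 h3 bd.
(* With L = - ln (b/a) and c = ln (11/4), the case hypothesis gives 2 l L <= (m + l) (2 L - c);
   multiply by u and apply the one-variable bound. *)
have h4 : 2 * l * u <= (m + l) * (ln (11 / 4) - ln 2).
  rewrite -(ler_pM2l L0).
  have h5 : 0 <= u * (2 * m * - L' - (m + l) * ln (11 / 4)) by rewrite mulr_ge0 ?subr_ge0.
  by rewrite -(ler_pM2l ml0) in bd; lra.
apply: le_trans h2 _; lra.
Qed.

(** * Bounds on ln k! *)

Lemma sum_ln_le (R : realType) (k : nat) :
  \sum_(1 <= i < k.+1) ln (i%:R : R) <= k%:R * ln k%:R.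
Proof.
rewrite mulr_natl -[X in _ *+ X]subn0 -subSS -sumr_const_nat.
rewrite big_nat [leRHS]big_nat; apply: ler_sum => i /andP[i1 ik].
by rewrite ler_ln ?posrE ?ltr0n ?ler_nat //; lia.
Qed.

(** Induction from k = 2, where (11/4)^2 <= 8. The step from K needs ln (11/4) <= 3 K (ln (K + 1) -
    ln K), and the right side is at least 3 K / (K + 1) >= 2. *)
Lemma sum_ln_le_slack (R : realType) (k : nat) : (2 <= k)%N ->
  3 * \sum_(1 <= i < k.+1) ln (i%:R : R) + k%:R * ln (11 / 4) <= 3 * k%:R * ln k%:R.
Proof.
elim: k => [//|[//|[|k] IHk] _].
  rewrite big_nat_recr //= big_nat1 ln1 add0r.
  have : ln (11 / 4 * (11 / 4)) <= ln (2 * 2 * 2) :> R by rewrite ler_ln ?posrE; lra.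
  by rewrite !lnM ?posrE; lra.
have {}IHk := IHk isT.
rewrite big_nat_recr //=.
move: (\sum_(_ <= _ < _) _) IHk => s; set K := k.+2 => IHk.
have K2 : 2 <= K%:R :> R by rewrite ler_nat.
have KS : K.+1%:R = K%:R + 1 :> R by rewrite -natr1.
have h1 : ln (11 / 4) <= 2 :> R.
  by rewrite (_ : 11 / 4 = 1 + 7 / 4); [apply: le_trans (le_ln1Dx _) _|]; lra.
have h2 : ln K%:R - ln K.+1%:R <= - (K%:R + 1)^-1 :> R.
  rewrite -ln_div ?posrE ?ltr0n // KS.
  have -> : K%:R / (K%:R + 1) = 1 + - (K%:R + 1)^-1 :> R by field; lra.
  by rewrite le_ln1Dx // ltrN2 invf_lt1; lra.
have h3 : 2 <= 3 * K%:R * (K%:R + 1)^-1 :> R by rewrite ler_pdivlMr; lra.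
have h4 : 3 * K%:R * (ln K%:R - ln K.+1%:R) <= 3 * K%:R * - (K%:R + 1)^-1 :> R.
  by rewrite ler_wpM2l //; lra.
rewrite KS in h4 *; lra.
Qed.

(** * Transfer of feasible points in both directions *)

Lemma ln_prod_nat (R : realType) (k : nat) (F : nat -> R) :
  (forall i, (1 <= i <= k)%N -> 0 < F i) ->
  0 < \prod_(1 <= i < k.+1) F i /\
  ln (\prod_(1 <= i < k.+1) F i) = \sum_(1 <= i < k.+1) ln (F i).
Proof.
elim: k => [|k IHk] hF; first by rewrite !big_geq // ln1.
have Fk : 0 < F k.+1 by apply: hF; rewrite ltnS leqnn.
have [|p0 e] := IHk; first by move=> i ik; apply: hF; lia.
rewrite big_nat_recr // [X in _ = X]big_nat_recr //=.
by split; [exact: mulr_gt0|rewrite lnM ?e].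
Qed.

Lemma le_ln_prod_constraint1 (R : realType) (k : nat) (a P : R) :
  (0 < k)%N -> 0 < a -> 0 < P ->
  (P <= k%:R `^ (k%:R / 2) * a ^+ k) = (ln P <= k%:R / 2 * ln k%:R + k%:R * ln a).
Proof.
move=> k0 a0 P0; have kR : 0 < k%:R :> R by rewrite ltr0n.
have ak : 0 < a ^+ k by exact: exprn_gt0.
rewrite -ler_ln ?posrE ?mulr_gt0 ?powR_gt0 // lnM ?posrE ?powR_gt0 //.
by rewrite ln_powR lnXn // (mulr_natl (ln a)).
Qed.

Lemma le_ln_prod_constraint2 (R : realType) (k m l : nat) (a b P : R) :
  (0 < k)%N -> (0 < m)%N -> (0 < l)%N -> 0 < a -> 0 < b -> 0 < P ->
  (P <= k%:R ^+ k * b ^+ m * (a + b) ^+ l / (m%:R `^ (m%:R / 2) * l%:R `^ (l%:R / 2))) =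
  (ln P <= k%:R * ln k%:R + m%:R * ln b + l%:R * ln (a + b)
           - (m%:R / 2 * ln m%:R + l%:R / 2 * ln l%:R)).
Proof.
rewrite -(ltr0n R k) -(ltr0n R m) -(ltr0n R l) => k0 m0 l0 a0 b0 P0.
have ab0 : 0 < a + b by exact: addr_gt0.
have kk := exprn_gt0 k k0; have bm := exprn_gt0 m b0; have abl := exprn_gt0 l ab0.
have mm := powR_gt0 (m%:R / 2) m0; have ll := powR_gt0 (l%:R / 2) l0.
rewrite -ler_ln ?posrE ?divr_gt0 ?mulr_gt0 // ln_div ?posrE ?mulr_gt0 //.
by rewrite !lnM ?posrE ?mulr_gt0 // !lnXn // !ln_powR !(mulr_natl (ln _)).
Qed.

Lemma lp_feasible_ln (R : realType) (n : nat) (p : n.-tuple R) :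
  prod_feasible p -> lp_feasible [tuple of [seq ln x | x <- p]].
Proof.
move=> [p0 h1 h2].
have lnp k : (1 <= k <= n)%N -> [seq ln x | x <- p]`_k.-1 = ln p`_k.-1.
  by move=> hk; rewrite (nth_map 0) // size_tuple; lia.
have sumE k : (k <= n)%N ->
    0 < \prod_(1 <= i < k.+1) p`_i.-1 /\
    \sum_(1 <= i < k.+1) [seq ln x | x <- p]`_i.-1 = ln (\prod_(1 <= i < k.+1) p`_i.-1).
  move=> kn; have [|P0 ->] := @ln_prod_nat R k (fun i => p`_i.-1).
    by move=> i ik; apply: p0; lia.
  by split=> //; apply: eq_big_nat => i ik; apply: lnp; lia.
have h1' k : (1 <= k <= n)%N ->
    ln (\prod_(1 <= i < k.+1) p`_i.-1) <= k%:R / 2 * ln k%:R + k%:R * ln p`_k.-1.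
  move=> hk; have [|P0 _] := sumE k; first by lia.
  by rewrite -le_ln_prod_constraint1 ?h1 ?p0 //; lia.
split=> [k hk|k l hk hl] /=.
  have [|_ ->] := sumE k; first by lia.
  by rewrite lnp ?h1'.
have [|P0 ->] := sumE k; first by lia.
rewrite !lnp; [|lia|lia].
have kE : k%:R = (k - l)%:R + l%:R :> R by rewrite -natrD subnK //; lia.
rewrite kE; apply: lp_constraint2_of_prod.
- by rewrite ltr0n; lia.
- by rewrite ltr0n; lia.
- by apply: p0; lia.
- by apply: p0; lia.
- by rewrite -kE h1' //; lia.
- rewrite -kE -le_ln_prod_constraint2 ?h2 ?p0 //; lia.
Qed.

Definition prod_of_lp (R : realType) (n : nat) (q : n.-tuple R) : n.-tuple R :=
  [tuple i.+1%:R `^ (3 / 2) * expR (tnth q i) | i < n].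

Lemma nth_prod_of_lp (R : realType) (n : nat) (q : n.-tuple R) (k : nat) :
  (1 <= k <= n)%N -> (prod_of_lp R n q)`_k.-1 = k%:R `^ (3 / 2) * expR q`_k.-1.
Proof.
case: k => [//|k] /= kn.
by rewrite -[k]/(nat_of_ord (Ordinal kn)) nth_mktuple (tnth_nth 0).
Qed.

Lemma prod_feasible_of_lp (R : realType) (n : nat) (q : n.-tuple R) :
  lp_feasible q -> prod_feasible (prod_of_lp R n q).
Proof.
move=> [h1 h2]; set p := prod_of_lp R n q.
have p0 k : (1 <= k <= n)%N -> 0 < p`_k.-1.
  by move=> hk; rewrite nth_prod_of_lp // mulr_gt0 ?expR_gt0 // powR_gt0 // ltr0n; lia.
have lnp k : (1 <= k <= n)%N -> ln p`_k.-1 = 3 / 2 * ln k%:R + q`_k.-1.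
  move=> hk; have k0 : 0 < k%:R :> R by rewrite ltr0n; lia.
  by rewrite nth_prod_of_lp // lnM ?posrE ?expR_gt0 ?powR_gt0 // ln_powR expRK.
have prodE k : (k <= n)%N -> 0 < \prod_(1 <= i < k.+1) p`_i.-1 /\
    ln (\prod_(1 <= i < k.+1) p`_i.-1) =
      3 / 2 * \sum_(1 <= i < k.+1) ln i%:R + \sum_(1 <= i < k.+1) q`_i.-1.
  move=> kn; have [|P0 ->] := @ln_prod_nat R k (fun i => p`_i.-1).
    by move=> i ik; apply: p0; lia.
  split=> //; rewrite mulr_sumr -big_split /=.
  by apply: eq_big_nat => i ik; apply: lnp; lia.
split=> [//|k hk|k l hk hl].
  have [|P0 lnP] := prodE k; first by lia.
  rewrite le_ln_prod_constraint1 ?p0 //; last by lia.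
  have hs := sum_ln_le R k.
  by rewrite lnP lnp //; have := h1 k hk; lra.
have [|P0 lnP] := prodE k; first by lia.
have hkn : (1 <= k <= n)%N by lia.
have hkl : (1 <= k + l <= n)%N by lia.
have pk := p0 k hkn; have pkl := p0 (k + l)%N hkl.
rewrite le_ln_prod_constraint2 //; [|lia|lia|lia].
have k0 : 0 < k%:R :> R by rewrite ltr0n; lia.
have m0 : 0 < (k - l)%:R :> R by rewrite ltr0n; lia.
have l0 : 0 < l%:R :> R by rewrite ltr0n; lia.
have kE : k%:R = (k - l)%:R + l%:R :> R by rewrite -natrD subnK //; lia.
(* The right side is bounded below by replacing k - l, l and k + l by k inside the logarithms and
   dropping p_(k+l) from the sum. With the factorial bound, both sides then carry exactly 2 k ln
   k. *)
have b1 : ln (k - l)%:R <= ln k%:R :> R by rewrite ler_ln ?posrE //; lra.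
have b2 : ln l%:R <= ln k%:R :> R by rewrite ler_ln ?posrE //; lra.
have b3 : ln k%:R <= ln (k + l)%:R :> R.
  by rewrite ler_ln ?posrE ?natrD ?addr_gt0 //; lra.
have b4 : ln p`_k.-1 <= ln (p`_k.-1 + p`_(k + l).-1).
  by rewrite ler_ln ?posrE ?addr_gt0 // lerDl ltW.
have hs : 3 * \sum_(1 <= i < k.+1) ln (i%:R : R) + k%:R * ln (11 / 4) <= 3 * k%:R * ln k%:R.
  have k2 : (2 <= k)%N by move: hk => /andP[].
  exact: sum_ln_le_slack.
have ek : ln (11 / 4 * k%:R) = ln (11 / 4) + ln k%:R :> R.
  by rewrite lnM ?posrE //; lra.
have := h2 k l hk hl; rewrite lnP ek.
rewrite (lnp k hkn) in b4; rewrite (lnp (k + l)%N hkl).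
have c1 := ler_wpM2l (ltW m0) b1.
have c2 := ler_wpM2l (ltW l0) b2.
have c3 := ler_wpM2l (ltW m0) b3.
have c4 := ler_wpM2l (ltW l0) b4.
move: hs c1 c2 c3 c4; rewrite kE; lra.
Qed.

(** * Comparison of the two suprema *)

Theorem proposition3p3 (R : realType) (n : nat) (hn : (1 <= n)%N) :
  ((n%:R `^ (- (3 / 2)))%:E * expeR (lp_opt R n) <= prod_opt R n
     <= expeR (lp_opt R n))%E.
Proof.
have n0 : 0 < n%:R :> R by rewrite ltr0n.
apply/andP; split; last first.
  apply: ge_ereal_sup => _ [p pf <-].
  have [p0 _ _] := pf.
  have p1 : 0 < p`_0 by apply: (p0 1%N); rewrite hn.
  have pn : 0 < p`_n.-1 by apply: p0; rewrite hn leqnn.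
  have -> : (p`_0 / p`_n.-1)%:E = expeR (ln p`_0 - ln p`_n.-1)%:E.
    by rewrite /= -ln_div ?posrE // lnK // posrE divr_gt0.
  rewrite lee_expeR; apply: ereal_sup_ubound.
  exists [tuple of [seq ln x | x <- p]]; first exact: lp_feasible_ln.
  by rewrite /= !(nth_map 0) // size_tuple ?hn // prednK.
have lb (q : n.-tuple R) : lp_feasible q ->
    ((n%:R `^ (- (3 / 2)) * expR (q`_0 - q`_n.-1))%:E <= prod_opt R n)%E.
  move=> /prod_feasible_of_lp pf; apply: ereal_sup_ubound; exists (prod_of_lp R n q) => //.
  have := @nth_prod_of_lp R n q 1; rewrite hn => -> //.
  rewrite nth_prod_of_lp ?hn ?leqnn // powR1 mul1r powRN expRB.
  by congr EFin; field; rewrite !gt_eqF ?powR_gt0 ?expR_gt0.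
have c0 : 0 < n%:R `^ (- (3 / 2)) :> R by exact: powR_gt0.
(* The zero point bounds [prod_opt] below by a positive real: this excludes -oo and lets a finite
   value be written as an exponential. *)
have q0 : lp_feasible [tuple (0 : R) | i < n].
  have nth0 k : [tuple (0 : R) | i < n]`_k = 0.
    have [kn|nk] := ltnP k n; last by rewrite nth_default // size_tuple.
    by rewrite -[k]/(nat_of_ord (Ordinal kn)) nth_mktuple.
  split=> [k hk|k l hk hl]; rewrite big1 => [|i _]; rewrite ?nth0 // !mulr0 !addr0.
    by rewrite mulr_ge0 ?divr_ge0 ?ler0n // ln_ge0 // ler1n; lia.
  rewrite mulr_ge0 ?divr_ge0 ?ler0n // ln_ge0 //.
  have : 1 <= k%:R :> R by rewrite ler1n; lia.
  lra.
have := lb _ q0; case: (prod_opt R n) lb => [s| |] lb //= s0; last by rewrite leey.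
have {}s0 : 0 < s by move: s0; rewrite lee_fin; apply: lt_le_trans; rewrite mulr_gt0 ?expR_gt0.
(* Comparing exponents turns the goal into an upper bound on the supremum [lp_opt], checked at each
   feasible q. *)
rewrite -(lnK c0) -[X in (X%:E * _)%E]/(expR _) -[(expR _)%:E]/(expeR (_%:E)) -expeRD.
rewrite -(lnK s0) -[(expR (ln s))%:E]/(expeR (ln s)%:E) lee_expeR -leeBrDl //.
apply: ge_ereal_sup => _ [q qf <-].
have := lb q qf; rewrite lee_fin -ler_ln ?posrE ?mulr_gt0 ?expR_gt0 //.
by rewrite lnM ?posrE ?expR_gt0 // expRK -EFinB lee_fin lerBrDl.
Qed.
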